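(* Let $N\ge1$ and let $H(N)$ be the space of self-adjoint complex $N\times N$ matrices. Each $z\in H(N)$ is of shape $S$ for a unique shape $S=S(z)$, and $S(z)$ is self-adjoint. Moreover, with $\mathcal{S}_{\mathrm{sa}}$ the set of self-adjoint shapes (viewed as self-adjoint matrices) and $H(N)/T(N)$ the set of $\mathrm{Ad}_{T(N)}$-orbits in $H(N)$, the map $$\mathcal{S}_{\mathrm{sa}}\to H(N)/T(N),\qquad S\mapsto \mathrm{Ad}_{T(N)}(S)$$ is bijective, with inverse map $\mathrm{Ad}_{T(N)}(z)\mapsto S(z)$.
   Context: $T(N)$ is the group of upper triangular complex $N\times N$ matrices with strictly positive diagonal entries, acting on $H(N)$ by $\mathrm{Ad}_x(z)=x^*zx$; $\mathrm{Ad}_{T(N)}(z)=\{t^*zt: t\in T(N)\}$ is the orbit of $z$. $[k]=\{1,\dots,k\}$; $\binom{[N]}{k}$ is the set of $k$-element subsets $I=\{i_1<\dots<i_k\}$ of $[N]$. $\le$ is the lexicographic total order on $\binom{[N]}{k}$, extended to pairs by $(J,I)\le(J',I')$ iff $J<J'$, or $J=J'$ and $I\le I'$. For $I,J\in\binom{[N]}{k}$ the minor $z_{I,J}$ is the determinant of the submatrix of $z$ with rows $I$ and columns $J$. For a bijection $\sigma:A\to B$ of finite totally ordered sets, $l(\sigma)$ is the number of pairs $i<j$ in $A$ with $\sigma(i)>\sigma(j)$. A **shape** is a pair $S=(\tau,u)$ with $\tau$ an involution of $[N]$ ($\tau^2=\mathrm{id}$) and $u:[N]\to\{0\}\cup\{w\in\mathbb{C}:|w|=1\}$,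 $i\mapsto u_i$, such that $u_i\neq0$ whenever $\tau(i)\ne i$. It is **self-adjoint** if $u_{\tau(i)}=\overline{u_i}$ for all $i$. A shape is identified with the matrix $S$ given by $Se_i=u_ie_{\tau(i)}$ on the standard basis of $\mathbb{C}^N$; it is self-adjoint iff this matrix is. The support is $P=\{p:u_p\ne0\}=\{p_1<\dots<p_M\}$ and the rank is $M=|P|$. Write $P_{[k]}=\{p_1,\dots,p_k\}$, $\tau(P_{[k]})=\{\tau(p_1),\dots,\tau(p_k)\}$, $u_{P_{[k]}}=\prod_{p\in P_{[k]}}u_p$. A matrix $z\in H(N)$ is **of shape** $S=(\tau,u)$ if the rank $M$ of $S$ equals the rank of $z$ and, for all $k\le M$: (i) for $I,J\in\binom{[N]}{k}$ the minor $z_{I,J}$ vanishes whenever $(J,I)<(P_{[k]},\tau(P_{[k]}))$; (ii) $(-1)^{l(\tau|_{P_{[k]}})}\,\overline{u_{P_{[k]}}}\,z_{\tau(P_{[k]}),P_{[k]}}>0$. *)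

(* Defs.v *)
From mathcomp Require Import all_boot all_order all_algebra.
From mathcomp Require Import sesquilinear spectral.
From mathcomp Require Import classical_sets functions reals.
From mathcomp Require Import complex.
Set Implicit Arguments.
Unset Strict Implicit.
Unset Printing Implicit Defensive.
Import Order.TTheory GRing.Theory Num.Theory.
Local Open Scope ring_scope.
Local Open Scope sesquilinear_scope.
Local Open Scope classical_set_scope.

(* As 'I_N is enumerated in increasing order, [enum I] is i_1 < ... < i_k.
   Listing [k]-subsets increasingly, the lexicographic order of seqlexi is the
   usual total order on them, and *l orders pairs by their first component. *)
Definition lex_lt (N : nat) (J I J' I' : {set 'I_N}) : bool :=
  (((enum J, enum I) : seqlexi 'I_N *l seqlexi 'I_N)
     < ((enum J', enum I') : seqlexi 'I_N *l seqlexi 'I_N))%O.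

(* The minor with rows I and columns J.  It is only meaningful (and only used)
   for #|I| = #|J|, in which case the default value of [nth] is irrelevant. *)
Definition minor (C : comPzRingType) (N : nat) (z : 'M[C]_N)
    (I J : {set 'I_N}) : C :=
  \det (\matrix_(a < #|I|, b < #|I|)
          z (enum_val a) (nth (enum_val a) (enum J) b)).

(* The length l(s) of s restricted to A. *)
Definition inversions (N : nat) (A : {set 'I_N}) (s : 'I_N -> 'I_N) : nat :=
  #|[set x : 'I_N * 'I_N |
      [&& x.1 \in A, x.2 \in A, (x.1 < x.2)%N & (s x.2 < s x.1)%N]]|.

Section Shapes.
Variables (R : realType) (N : nat).
Local Notation C := R[i].

Record Shape := MkShape {
  tau : {ffun 'I_N -> 'I_N};
  phase : {ffun 'I_N -> C};
  _ : [forall i, tau (tau i) == i];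
  _ : [forall i, (phase i == 0) || (`|phase i| == 1)];
  _ : [forall i, (tau i != i) ==> (phase i != 0)] }.

(* Column i is S e_i = u_i e_(tau i). *)
Definition shape_mx (S : Shape) : 'M[C]_N :=
  \matrix_(j, i) (if j == tau S i then phase S i else 0).

Definition shape_sa (S : Shape) : Prop :=
  forall i, phase S (tau S i) = (phase S i)^*.

Definition supp (S : Shape) : {set 'I_N} := [set i | phase S i != 0]%SET.

Definition shape_rank (S : Shape) : nat := #|supp S|.

(* The k smallest elements p_1 < ... < p_k of the support. *)
Definition supp_init (S : Shape) (k : nat) : {set 'I_N} :=
  [set i in take k (enum (supp S))]%SET.

Definition of_shape (z : 'M[C]_N) (S : Shape) : Prop :=
  shape_rank S = \rank z /\
  forall k : nat, (k <= shape_rank S)%N ->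
    let P := supp_init S k in
    let tP := [set tau S p | p in P]%SET in
    (forall I J : {set 'I_N}, #|I| = k -> #|J| = k ->
       lex_lt J I P tP -> minor z I J = 0) /\
    0 < (-1) ^+ inversions P (tau S) * (\prod_(p in P) phase S p)^*
          * minor z tP P.

Definition herm : set 'M[C]_N := [set z | z \is hermsymmx].

Definition triang : set 'M[C]_N :=
  [set t | (forall i j : 'I_N, (j < i)%N -> t i j = 0) /\
           (forall i, 0 < t i i)].

Definition Ad_orbit (z : 'M[C]_N) : set 'M[C]_N :=
  [set t^t* *m z *m t | t in triang].

(* The orbit space H(N)/T(N): the set of orbits of self-adjoint matrices. *)
Definition herm_orbits : set (set 'M[C]_N) := Ad_orbit @` herm.

Definition sa_shapes : set Shape := [set S | shape_sa S].

End Shapes.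

(* Main.v *)
Require Import Defs.
From mathcomp Require Import all_boot all_order all_algebra.
From mathcomp Require Import fingroup perm sesquilinear.
From mathcomp Require Import boolp classical_sets functions reals.
From mathcomp Require Import complex.
Set Implicit Arguments.
Unset Strict Implicit.
Unset Printing Implicit Defensive.
Import Order.TTheory GRing.Theory Num.Theory.
Local Open Scope ring_scope.
Local Open Scope sesquilinear_scope.

(** By multilinearity and triangularity, a minor of z t with columns J is a
    combination of minors of z with lexicographically smaller columns, plus the
    minor at J times a positive number.  Hence, below and at the first pair
    (J, I) with a nonvanishing minor, congruence by T(N) only rescales minors
    positively, so being of shape S is an invariant of orbits; and S is
    recovered from those first pairs and the phases of the minors there.
    Self-adjoint Gaussian elimination with pivots taken at the smallest
    available indices uses upper triangular congruences only and ends at a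
    self-adjoint shape matrix, which is of its own shape. *)

(** * Lexicographic comparison of subsets of equal size *)

Definition set_lt (N : nat) (A B : {set 'I_N}) : bool :=
  ((enum A : seqlexi 'I_N) < enum B)%O.

Section LexSubsets.
Variable N : nat.
Implicit Types (A B I J : {set 'I_N}).

Lemma set_lt_irr A : set_lt A A = false.
Proof. exact: ltxx. Qed.

Lemma enum_set_inj A B : enum A = enum B -> A = B.
Proof. by move=> e; apply/setP=> x; rewrite -(mem_enum A) e mem_enum. Qed.

Lemma lex_ltE J I J' I' :
  lex_lt J I J' I' = set_lt J J' || ((J == J') && set_lt I I').
Proof.
rewrite /lex_lt ltEprodlexi /set_lt /=.
set a : seqlexi 'I_N := enum J; set b : seqlexi 'I_N := enum J'.
have -> : (J == J') = (a == b).
  by apply/eqP/eqP => [E|/enum_set_inj//]; rewrite /a /b E.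
by case: (ltgtP a b) => //= e; rewrite e lexx.
Qed.

Lemma set_lt_total A B : [|| set_lt A B, A == B | set_lt B A].
Proof.
rewrite /set_lt.
case: (ltgtP (enum A : seqlexi 'I_N) (enum B)) => e; rewrite ?orbT //.
by rewrite (enum_set_inj e) eqxx.
Qed.

(** Below [m] both filters emit the same entries. At [m] the first emits [m], while the second can
    only continue with something larger. Equal sizes exclude the case where the second list ends
    there, which would make it a prefix and hence the smaller one. *)
Lemma ltn_filter_lexi (a b : pred 'I_N) (m : 'I_N) (s : seq 'I_N) :
  sorted ltn (map val s) -> m \in s -> a m -> ~~ b m ->
  (forall i : 'I_N, i < m -> a i = b i)%N ->
  size (filter a s) = size (filter b s) ->
  ((filter a s : seqlexi 'I_N) < filter b s)%O.
Proof.
move=> + + am bm ab; elim: s => [|x s IHs] //= ss.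
have allx : all (fun y : 'I_N => x < y)%N s.
  move: ss; rewrite path_sortedE; last exact: ltn_trans.
  by case/andP; rewrite all_map.
rewrite inE; case: eqVneq => [mx _|mx /= ms].
  rewrite -mx am (negbTE bm) /=.
  case E : (filter b s) => [|y r] //= [_].
  rewrite ltxi_cons.
  have : y \in filter b s by rewrite E inE eqxx.
  rewrite mem_filter => /andP[_ /(allP allx) mly].
  have xy : (x < y)%O := mly.
  by rewrite mx (ltW xy) leNgt xy.
have xm : (x < m)%N by exact: (allP allx).
rewrite (ab _ xm); case: (b x) => /=; last exact: IHs (path_sorted ss) ms.
by case=> /(IHs (path_sorted ss) ms); rewrite ltxi_cons lexx.
Qed.

Lemma set_lt_first_diff A B (m : 'I_N) :
  #|A| = #|B| -> m \in A -> m \notin B ->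
  (forall i : 'I_N, i < m -> (i \in A) = (i \in B))%N -> set_lt A B.
Proof.
move=> cAB mA mB AB; rewrite /set_lt.
have E (C : {set _}) : enum C = [seq x <- enum 'I_N | x \in C] by rewrite enumT.
rewrite (E A) (E B); apply: (@ltn_filter_lexi _ _ m) => //.
- by rewrite val_enum_ord iota_ltn_sorted.
- by rewrite mem_enum.
- by rewrite -(E A) -(E B) -!cardE.
Qed.

Lemma first_diff A B : A != B ->
  exists2 m, (m \in A) (+) (m \in B) &
    forall i : 'I_N, (i < m)%N -> (i \in A) = (i \in B).
Proof.
move=> AB.
have [i0 i0P] : exists i, (i \in A) (+) (i \in B).
  apply/existsP; apply: contraNT AB; rewrite negb_exists => /forallP nd.
  apply/eqP/setP => i.
  by move: (nd i) => /=; case: (i \in A); case: (i \in B).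
case: (@arg_minnP _ i0 (fun i => (i \in A) (+) (i \in B)) val i0P) => m mP mmin.
exists m => // i im; apply/eqP; apply: contraTT im => iAB.
rewrite -leqNgt; apply: mmin.
by move: iAB; case: (i \in A); case: (i \in B).
Qed.

(** Let [m] be the first difference of the images. If it lay in the image of [g] only, that image
    would have one more element up to [m] than the image of [f]. But [g b <= m] forces [f b <= m],
    so the count goes the other way. *)
Lemma dominated_imset_lt k (f g : 'I_k -> 'I_N) :
  injective f -> injective g -> (forall b, f b <= g b)%N ->
  f @: 'I_k = g @: 'I_k :> {set 'I_N} \/ set_lt (f @: 'I_k) (g @: 'I_k).
Proof.
move=> fi gi fg; set A := f @: 'I_k; set B := g @: 'I_k.
have [AB|/first_diff [m mP mmin]] := eqVneq A B; [by left|right].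
have cAB : #|A| = #|B| by rewrite !card_imset.
have [mA|mA] := boolP (m \in A).
  by apply: set_lt_first_diff mmin => //; move: mP; rewrite mA.
have mB : m \in B by move: mP; rewrite (negbTE mA).
have cnt (h : 'I_k -> 'I_N) : injective h ->
    #|[set x in h @: 'I_k | (x <= m)%N]| = #|[set b | (h b <= m)%N]|.
  move=> hi; rewrite -(card_imset _ hi); apply: eq_card => x.
  apply/idP/imsetP.
    rewrite inE => /andP[/imsetP [b _ ->] hb].
    by exists b => //; rewrite inE.
  by case=> b; rewrite inE => hb ->; rewrite inE hb andbT imset_f.
have le1 : (#|[set x in B | (x <= m)%N]| <= #|[set x in A | (x <= m)%N]|)%N.
  rewrite !cnt //; apply: subset_leq_card; apply/fintype.subsetP => b.
  by rewrite !inE; apply: leq_trans.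
have : [set x in B | (x <= m)%N] = m |: [set x in A | (x <= m)%N].
  apply/setP => x; rewrite !inE.
  case: (ltngtP x m) => [xm|xm|/val_inj->]; rewrite ?andbF ?andbT.
  - by rewrite -mmin // -val_eqE /= (ltn_eqF xm).
  - by rewrite -val_eqE /= (gtn_eqF xm).
  - by rewrite eqxx mB.
move=> E; move: le1; rewrite E cardsU1 inE (negbTE mA) /=.
by rewrite add1n ltnn.
Qed.

(** Equal images have equal sums of elements, and a termwise inequality between equal sums is an
    equality in every term. *)
Lemma dominated_imset_eq k (f g : 'I_k -> 'I_N) :
  injective f -> injective g -> (forall b, f b <= g b)%N ->
  f @: 'I_k = g @: 'I_k :> {set 'I_N} -> f =1 g.
Proof.
move=> fi gi fg AB b.
have := @leqif_sum _ predT (fun b => f b == g b) (fun b => f b : nat)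
          (fun b => g b : nat) (fun b _ => leqif_eq (fg b)).
have S (h : 'I_k -> 'I_N) : injective h ->
    (\sum_b h b = \sum_(x in h @: 'I_k) x)%N.
  move=> hi; rewrite big_imset /=; last by move=> ? ? _ _; apply: hi.
  by apply: eq_bigl => x; rewrite inE.
case=> _; rewrite S // AB -S // eqxx => /esym/forallP /(_ b) /eqP.
by [].
Qed.

Lemma nth_enum_inj x0 A k : #|A| = k ->
  injective (fun b : 'I_k => nth x0 (enum A) b).
Proof.
move=> cA b c /eqP; rewrite nth_uniq ?enum_uniq -?cardE ?cA //.
by move/eqP/val_inj.
Qed.

Lemma nth_enum_imset x0 A k : #|A| = k ->
  (fun b : 'I_k => nth x0 (enum A) b) @: 'I_k = A.
Proof.
move=> cA; apply/eqP; rewrite eqEcard card_imset; last exact: nth_enum_inj.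
rewrite card_ord cA leqnn andbT.
apply/fintype.subsetP=> x /imsetP [b _ ->]; rewrite -mem_enum mem_nth //.
by rewrite -cardE cA.
Qed.

End LexSubsets.

(** * Minors of a product with an upper triangular factor *)

Section Minors.
Variables (C : comPzRingType) (N : nat).
Implicit Types (z t : 'M[C]_N) (I J L : {set 'I_N}).

Lemma minorE x0 k z I J : #|I| = k -> #|J| = k ->
  minor z I J =
    \det (\matrix_(a < k, b < k) z (nth x0 (enum I) a) (nth x0 (enum J) b)).
Proof.
move=> <- cJ; rewrite /minor; congr (\det _); apply/matrixP => a b; rewrite !mxE.
rewrite -(enum_val_nth x0); congr (z _ _).
by apply: set_nth_default; rewrite -cardE cJ.
Qed.

Lemma minor_tr (x0 : 'I_N) z I J : #|I| = #|J| -> minor z^T I J = minor z J I.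
Proof.
move=> cIJ; rewrite (@minorE x0 #|J|) // (@minorE x0 #|J|) // -det_tr.
by congr (\det _); apply/matrixP => a b; rewrite !mxE.
Qed.

(** Each column of the product is a combination of columns of [Z]; multilinearity expands over all
    choices [f], as in the Cauchy-Binet formula before terms are grouped by image. The
    transpositions make the Leibniz product run over columns. *)
Lemma det_mul_colfun k (Z : 'M[C]_(k, N)) t (j : 'I_k -> 'I_N) :
  \det (\matrix_(a, b) (Z *m t) a (j b)) =
  \sum_(f : {ffun 'I_k -> 'I_N})
    (\prod_b t (f b) (j b)) * \det (\matrix_(a, b) Z a (f b)).
Proof.
rewrite -det_tr {1}/determinant.
under eq_bigr => s _.
  under eq_bigr => b _ do rewrite !mxE.
  rewrite bigA_distr_bigA mulr_sumr.
  over.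
rewrite exchange_big; apply: eq_bigr => f _ /=.
rewrite -det_tr /determinant mulr_sumr; apply: eq_bigr => s _.
rewrite mulrCA; congr (_ * _); rewrite mulrC -big_split.
by apply: eq_bigr => b _; rewrite !mxE.
Qed.

(** The two matrices differ by a permutation of columns. Only vanishing is transferred, so the sign
    need not be tracked. *)
Lemma det_reindex_cols k (Z : 'M[C]_(k, N)) (f g : 'I_k -> 'I_N) :
  injective f -> injective g -> f @: 'I_k = g @: 'I_k :> {set 'I_N} ->
  \det (\matrix_(a, b) Z a (g b)) = 0 -> \det (\matrix_(a, b) Z a (f b)) = 0.
Proof.
move=> fi gi fg Z0.
have h b : exists c, f b == g c.
  have : f b \in g @: 'I_k by rewrite -fg imset_f.
  by case/imsetP => c _ ->; exists c.
pose s b := xchoose (h b).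
have sP b : f b = g (s b) by apply/eqP/(xchooseP (h b)).
have si : injective s by move=> b c e; apply: fi; rewrite !sP e.
have -> : \matrix_(a, b) Z a (f b) =
    col_perm (perm si) (\matrix_(a, b) Z a (g b)).
  by apply/matrixP => a b; rewrite !mxE permE sP.
by rewrite col_permE det_mulmx Z0 mul0r.
Qed.

(* Only column tuples f with f b <= j_b contribute to the multilinear
   expansion, and up to reordering these select lexicographically earlier
   minors, apart from the tuple of J itself. *)
Lemma minor_mul_upper (x0 : 'I_N) z t I J :
  (forall i j : 'I_N, (j < i)%N -> t i j = 0) -> #|I| = #|J| ->
  (forall L, #|L| = #|J| -> set_lt L J -> minor z I L = 0) ->
  minor (z *m t) I J = (\prod_(j in J) t j j) * minor z I J.
Proof.
move=> tU cIJ z0; set k := #|J|.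
pose j (b : 'I_k) := nth x0 (enum J) b.
pose Z : 'M_(k, N) := \matrix_(a, l) z (nth x0 (enum I) a) l.
have ji : injective j by apply: nth_enum_inj.
have jJ : j @: 'I_k = J by apply: nth_enum_imset.
have EZ L : #|L| = k ->
    minor z I L = \det (\matrix_(a, b < k) Z a (nth x0 (enum L) b)).
  move=> cL; rewrite (@minorE x0 k) //.
  by congr (\det _); apply/matrixP => a b; rewrite !mxE.
have -> : minor (z *m t) I J = \det (\matrix_(a, b) (Z *m t) a (j b)).
  rewrite (@minorE x0 k) //; congr (\det _); apply/matrixP => a b.
  by rewrite !mxE; apply: eq_bigr => l _; rewrite !mxE.
rewrite det_mul_colfun (bigD1 (finfun j)) //= [X in _ + X]big1 => [|f fj].
  rewrite addr0 EZ //; congr (_ * _); last first.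
    by congr (\det _); apply/matrixP => a b; rewrite !mxE ffunE.
  rewrite -[in RHS]jJ big_imset /=; last by move=> ? ? _ _; apply: ji.
  by apply: eq_big => [b|b _]; rewrite ?ffunE // inE.
have [/injectiveP fi|/injectivePn [b [c bc fbc]]] := boolP (injectiveb f);
  last first.
  rewrite -det_tr (determinant_alternate bc) ?mulr0 // => a.
  by rewrite !mxE fbc.
have [/forallP fle|] := boolP [forall b, (f b <= j b)%N]; last first.
  rewrite negb_forall => /existsP [b]; rewrite -ltnNge => /tU t0.
  by rewrite (bigD1 b) //= t0 !mul0r.
have [E|] := dominated_imset_lt fi ji fle.
  case/eqP: fj; apply/ffunP => b.
  by rewrite (dominated_imset_eq fi ji fle E) ffunE.
rewrite jJ => lt.
have cL : #|f @: 'I_k| = k by rewrite card_imset // card_ord.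
rewrite (det_reindex_cols fi (nth_enum_inj (x0 := x0) cL)) ?mulr0 //.
  by rewrite nth_enum_imset.
by rewrite -EZ // z0.
Qed.

End Minors.

Lemma minor_conjtr (C : numClosedFieldType) (N : nat) (x0 : 'I_N)
    (z : 'M[C]_N) (I J : {set 'I_N}) :
  #|I| = #|J| -> minor (z^t*) I J = (minor z J I)^*.
Proof.
move=> cIJ; rewrite -(minor_tr x0) // /minor -det_map_mx; congr (\det _).
by apply/matrixP => a b; rewrite !mxE.
Qed.

(** * The group T(N), its orbits, and invariance of the shape *)

Section Congruence.
Variables (R : realType) (N : nat).
Local Notation C := R[i].
Implicit Types (z t : 'M[C]_N) (S : Shape R N).

Lemma conjtr_mul n (A B : 'M[C]_n) : (A *m B)^t* = B^t* *m A^t*.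
Proof. by rewrite trmx_mul map_mxM. Qed.

Lemma conjtrK n (A : 'M[C]_n) : (A^t*)^t* = A.
Proof. by apply/matrixP => i j; rewrite !mxE conjCK. Qed.

Lemma hermE z : herm z <-> z^t* = z.
Proof.
rewrite /herm /= is_hermitianmxE expr0 scale1r.
by split=> [/eqP<-|->].
Qed.

Lemma herm_act z t : herm z -> herm (t^t* *m z *m t).
Proof. by rewrite !hermE => hz; rewrite !conjtr_mul conjtrK hz mulmxA. Qed.

Lemma det_triang t : triang t -> \det t = \prod_i t i i.
Proof.
case=> tU _; rewrite -det_tr det_trig.
  by apply: eq_bigr => i _; rewrite mxE.
by apply/is_trig_mxP => i j ij; rewrite mxE tU.
Qed.

Lemma triang_unit t : triang t -> t \in unitmx.
Proof.
move=> tT; rewrite unitmxE det_triang // unitfE.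
by apply/prodf_neq0 => i _; case: tT => _ /(_ i) /gt_eqF ->.
Qed.

Lemma triang1 : triang (1%:M : 'M[C]_N).
Proof.
split=> [i j ij|i]; rewrite mxE ?eqxx ?ltr01 //.
by rewrite -val_eqE gtn_eqF.
Qed.

Lemma triangM s t : triang s -> triang t -> triang (s *m t).
Proof.
move=> [sU s0] [tU t0]; split=> [i j ij|i]; rewrite mxE.
  apply: big1 => k _; case: (ltnP k i) => [ki|ik]; first by rewrite sU // mul0r.
  by rewrite tU ?mulr0 // (leq_trans ij).
rewrite (bigD1 i) //= big1 => [|k ki]; first by rewrite addr0 mulr_gt0.
case: (ltnP k i) => [?|ik]; first by rewrite sU // mul0r.
by rewrite tU ?mulr0 // ltn_neqAle eq_sym val_eqE ki.
Qed.

Lemma triangV t : triang t -> triang (invmx t).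
Proof.
move=> tT; have tu := triang_unit tT; case: tT => tU t0.
have E i j : \sum_k t i k * invmx t k j = (i == j)%:R.
  by have := congr1 (fun A : 'M_N => A i j) (mulmxV tu); rewrite !mxE.
have U (i j : 'I_N) : (j < i)%N -> invmx t i j = 0.
  (* The induction runs from the bottom row upwards: row [i] of the inverse is solved from the rows
     below it. *)
  have [n] := ubnP (N - i); elim: n i => // n IHn i le_n ji.
  have := E i j; rewrite -val_eqE gtn_eqF // (bigD1 i) //= big1 => [|k ki].
    by rewrite addr0 => /eqP; rewrite mulf_eq0 gt_eqF //= => /eqP.
  have [ik|?] := ltnP i k; last first.
    by rewrite tU ?mul0r // ltn_neqAle val_eqE ki.
  rewrite IHn ?mulr0 //; last exact: ltn_trans ik.
  by apply: leq_trans (ltn_sub2l _ ik) le_n; apply: ltn_ord.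
split=> // i; have := E i i; rewrite eqxx (bigD1 i) //= big1 => [|k ki].
  rewrite addr0 => e; have : 0 < t i i * invmx t i i by rewrite e ltr01.
  by rewrite pmulr_rgt0.
have [ik|?] := ltnP i k; first by rewrite U // mulr0.
by rewrite tU ?mul0r // ltn_neqAle val_eqE ki.
Qed.

Lemma Ad_orbit_act z t : triang t -> Ad_orbit (t^t* *m z *m t) = Ad_orbit z.
Proof.
move=> tT; apply/seteqP; split=> [_ [s sT <-]|_ [s sT <-]].
  exists (t *m s); first exact: triangM.
  by rewrite conjtr_mul !mulmxA.
exists (invmx t *m s); first exact: triangM (triangV tT) _.
have tu := triang_unit tT.
have vt : (invmx t)^t* *m t^t* = 1%:M by rewrite -conjtr_mul mulmxV // trmx1 map_mx1.
rewrite conjtr_mul -mulmxA -(mulmxA _ t) (mulKVmx tu) -(mulmxA (t^t*)).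
by rewrite [LHS]mulmxA -(mulmxA (s^t*)) vt mulmx1 mulmxA.
Qed.

Lemma Ad_orbit_refl z : Ad_orbit z z.
Proof.
by exists 1%:M; [exact: triang1|rewrite trmx1 map_mx1 mul1mx mulmx1].
Qed.

(** The two factors are treated in turn, the left one by passing to the conjugate transpose. Because
    the order on pairs compares columns first, the hypothesis covers all row sets for columns before
    [J], and earlier row sets for [J] itself. *)
Lemma minor_act (x0 : 'I_N) z t (I J : {set 'I_N}) : triang t -> #|I| = #|J| ->
  (forall I' J' : {set 'I_N}, #|I'| = #|J| -> #|J'| = #|J| -> lex_lt J' I' J I ->
     minor z I' J' = 0) ->
  minor (t^t* *m z *m t) I J =
    (\prod_(j in J) t j j) * (\prod_(i in I) t i i) * minor z I J.
Proof.
move=> [tU t0] cIJ z0.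
(* Columns [L] before [J] are included because the later step with the right factor needs those
   minors of [t^t* *m z] to vanish. *)
have left (L : {set 'I_N}) : #|L| = #|J| -> (set_lt L J) || (L == J) ->
    minor (t^t* *m z) I L = (\prod_(i in I) t i i) * minor z I L.
  move=> cL LJ; rewrite -[t^t* *m z]conjtrK (minor_conjtr x0) ?cL //.
  rewrite conjtr_mul conjtrK (minor_mul_upper x0) ?cL // => [|K cK KI].
    rewrite (minor_conjtr x0) ?cL // rmorphM /= conjCK rmorph_prod.
    congr (_ * _); apply: eq_bigr => i _; exact/conj_Creal/gtr0_real.
  rewrite (minor_conjtr x0) ?cL ?cK // z0 ?conjC0 ?cK // lex_ltE.
  by case/orP: LJ => ->; rewrite ?KI ?orbT.
rewrite (minor_mul_upper x0 tU cIJ) => [|L cL LJ].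
  by rewrite left ?eqxx ?orbT // mulrA.
by rewrite left ?LJ // z0 ?mulr0 // lex_ltE LJ.
Qed.

Lemma tauK S : involutive (tau S).
Proof. by case: S => ta u /= /forallP h _ _ i; apply/eqP. Qed.

Lemma phase0_or_norm1 S i : phase S i = 0 \/ `|phase S i| = 1.
Proof.
by case: S => ta u /= _ /forallP /(_ i) /orP [] /eqP; [left|right].
Qed.

Lemma tau_notin_supp S i : i \notin supp S -> tau S i = i.
Proof.
rewrite inE negbK; case: S => ta u /= _ _ /forallP /(_ i).
by move=> h /eqP u0; apply/eqP; move: h; rewrite u0 eqxx implybF negbK.
Qed.

Lemma card_supp_init S k : (k <= shape_rank S)%N -> #|supp_init S k| = k.
Proof.
move=> kr; rewrite cardsE.
have /card_uniqP -> := take_uniq k (enum_uniq (supp S)).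
by rewrite size_take -cardE; case: ltngtP kr => // -> _.
Qed.

Lemma of_shape_act (x0 : 'I_N) z t S : triang t -> of_shape z S ->
  of_shape (t^t* *m z *m t) S.
Proof.
move=> tT [rk shp]; have tu := triang_unit tT.
split.
  rewrite rk mxrankMfree ?row_free_unit // eqmxMfull //.
  by rewrite row_full_unit map_unitmx unitmx_tr.
move=> k kr P tP; have [z0 zpos] := shp k kr.
have cP : #|P| = k by apply: card_supp_init.
have ctP : #|tP| = k by rewrite card_imset //; apply/inv_inj/tauK.
split=> [I J cI cJ lt|].
  rewrite (minor_act x0) ?cJ //; first by rewrite z0 ?mulr0.
  move=> I' J' cI' cJ' lt'; apply: z0 => //; exact: lt_trans lt' lt.
rewrite (minor_act x0) ?ctP ?cP // mulrCA mulr_gt0 //.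
by apply: mulr_gt0; apply: prodr_gt0 => i _; case: tT.
Qed.

End Congruence.

(** * Increasing enumerations, the rank of a diagonal matrix, and Vandermonde signs *)

Section SortedEnum.
Variable N : nat.
Implicit Types (A : {set 'I_N}).

Lemma sorted_enum_set A : sorted <%O (enum A).
Proof.
have E : enum A = [seq x <- enum 'I_N | x \in A] by rewrite enumT.
rewrite E; apply: sorted_filter; first exact: lt_trans.
have := iota_ltn_sorted 0 N; rewrite -val_enum_ord sorted_map.
by apply: sub_sorted.
Qed.

Lemma ltn_nth_enum x0 A b c : (b < #|A|)%N -> (c < #|A|)%N ->
  (nth x0 (enum A) b < nth x0 (enum A) c)%N = (b < c)%N.
Proof.
rewrite !cardE => bA cA.
by rewrite -[RHS](lt_sorted_ltn_nth x0 (sorted_enum_set A)).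
Qed.

Lemma mem_nth_enum x0 A b : (b < #|A|)%N -> nth x0 (enum A) b \in A.
Proof. by move=> bA; rewrite -mem_enum mem_nth // -cardE. Qed.

End SortedEnum.

(** Writing the matrix as a sum of rank-one terms bounds the rank above. For the lower bound, a
    diagonal matrix supported on the zeros of [d] is added: the sum is invertible, and subadditivity
    of rank applies. *)
Lemma rank_diag_mx (F : fieldType) n (d : 'rV[F]_n) :
  \rank (diag_mx d) = #|[set i : 'I_n | (d 0 i != 0)%R]%SET|.
Proof.
pose nz (e : 'rV[F]_n) : {set 'I_n} := [set i | e 0 i != 0]%SET.
rewrite -/(nz d).
have le (e : 'rV[F]_n) : (\rank (diag_mx e) <= #|nz e|)%N.
  have -> : diag_mx e = \sum_(i in nz e) e 0 i *: delta_mx i i.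
    rewrite [LHS]matrix_sum_delta [RHS]big_mkcond; apply: eq_bigr => i _.
    rewrite (bigD1 i) //= big1 => [|j ji].
      by rewrite addr0 mxE eqxx inE; case: eqVneq => [->|//]; rewrite scale0r.
    by rewrite mxE eq_sym (negbTE ji) scale0r.
  rewrite -sum1_card; elim/big_rec2: _ => [|i m A _ Am]; first by rewrite mxrank0.
  apply: leq_trans (mxrank_add _ _) (leq_add _ Am).
  by apply: leq_trans (mxrank_scale _ _) _; rewrite mxrank_delta.
apply/eqP; rewrite eqn_leq le /=.
pose e : 'rV[F]_n := \row_i (d 0 i == 0)%:R.
have : diag_mx d + diag_mx e \in unitmx.
  rewrite -raddfD unitmxE det_diag unitfE; apply/prodf_neq0 => i _.
  rewrite !mxE; have [->|h] := eqVneq (d 0 i) 0; first by rewrite add0r oner_eq0.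
  by rewrite addr0.
rewrite -row_full_unit => /eqP e1.
have := mxrank_add (diag_mx d) (diag_mx e); rewrite e1 => h.
have := leq_trans h (leq_add (leqnn _) (le e)).
have -> : nz e = (~: nz d)%SET.
  apply/setP => i; rewrite !inE mxE.
  by case: (d 0 i == 0); rewrite ?oner_eq0 ?eqxx.
by rewrite -{1}(card_ord n) -(cardsC (nz d)) leq_add2r.
Qed.

(** In the product formula the factor of a pair of positions is negative exactly when the pair is an
    inversion of [f]. *)
Lemma vandermonde_sign (F : numDomainType) k (f : 'I_k -> nat) :
  injective f ->
  0 < (-1) ^+ #|[set x : 'I_k * 'I_k | (x.1 < x.2)%N && (f x.2 < f x.1)%N]%SET|
      * \det (Vandermonde k (\row_b (f b)%:R : 'rV[F]_k)).
Proof.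
move=> fi; rewrite det_Vandermonde pair_big_dep /= -prodr_const big_mkcond.
rewrite [X in _ * X]big_mkcond -big_split; apply: prodr_gt0 => -[a b] _ /=.
rewrite inE /= !mxE; case: ltnP => [ab|_]; last by rewrite mul1r ltr01.
case: ltngtP => [fba|fab|/fi e] /=.
- by rewrite mulN1r opprB subr_gt0 ltr_nat.
- by rewrite mul1r subr_gt0 ltr_nat.
- by rewrite e ltnn in ab.
Qed.

(** * A shape matrix is of its own shape *)

Section ShapeMatrix.
Variables (R : realType) (N : nat).
Local Notation C := R[i].
Implicit Types (z : 'M[C]_N) (S : Shape R N).

Lemma rank_shape_mx S : \rank (shape_mx S) = shape_rank S.
Proof.
have taui : injective (tau S) by apply/inv_inj/tauK.
have -> : shape_mx S = perm_mx (perm taui) *m diag_mx (\row_i phase S i).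
  rewrite -row_permE; apply/matrixP => j i; rewrite !mxE permE.
  by rewrite -(inj_eq taui) tauK; case: eqVneq => [->|_].
rewrite eqmxMfull ?row_full_unit ?unitmx_perm // rank_diag_mx.
by congr #|pred_of_set _|; apply/setP => i; rewrite !inE mxE.
Qed.

(** If the first difference [m] lay in [J] only, it would come after the first [k] support elements.
    All of [P] would then lie below [m], where the sets agree, so [J] would contain [P] and [m],
    which is one element too many. *)
Lemma supp_init_min S k (J : {set 'I_N}) : J \subset supp S -> #|J| = k ->
  J = supp_init S k \/ set_lt (supp_init S k) J.
Proof.
move=> /fintype.subsetP JS cJ; set P := supp_init S k.
have cP : #|P| = #|J|.
  rewrite card_supp_init // -cJ; apply: subset_leq_card.
  by apply/fintype.subsetP.
have [->|/first_diff [m mP mmin]] := eqVneq J P; [by left|right].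
have [mP'|mP'] := boolP (m \in P).
  by apply: (set_lt_first_diff (m := m)) => // [|i im];
     [move: mP; rewrite mP'; case: (m \in J)|rewrite mmin].
have mJ : m \in J by move: mP; rewrite (negbTE mP'); case: (m \in J).
have Pm x : x \in P -> (x < m)%N.
  have : m \in take k (enum (supp S)) ++ drop k (enum (supp S)).
    by rewrite cat_take_drop mem_enum JS.
  rewrite mem_cat; move: mP'; rewrite inE => /negbTE -> /= md.
  rewrite inE => xt; have := sorted_enum_set (supp S).
  rewrite (sorted_pairwise lt_trans) -{1}(cat_take_drop k (enum (supp S))).
  by rewrite pairwise_cat => /andP[/allrelP /(_ _ _ xt md)].
have : (#|m |: P| <= #|J|)%N.
  apply: subset_leq_card; apply/fintype.subsetP => x; rewrite in_setU1.
  by case/orP => [/eqP->//|xP]; rewrite mmin // Pm.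
by rewrite cardsU1 mP' cP ltnn.
Qed.

(** A nonzero Leibniz term matches every row of [I] with a column of [J] through a nonzero entry,
    and the only such entry of column [j] sits in row [tau S j]. *)
Lemma minor_shape_neq0 (x0 : 'I_N) S (I J : {set 'I_N}) : #|I| = #|J| ->
  minor (shape_mx S) I J != 0 ->
  J \subset supp S /\ I = [set tau S j | j in J]%SET.
Proof.
move=> cIJ; rewrite (@minorE _ _ x0 #|J|) // => d0.
have [s sP] : exists s : 'S_#|J|,
    \prod_(a < #|J|) shape_mx S (nth x0 (enum I) a) (nth x0 (enum J) (s a)) != 0.
  apply/existsP; apply: contraNT d0; rewrite negb_exists => /forallP h.
  apply/eqP; apply: big1 => s _; move: (h s); rewrite negbK => /eqP e.
  by under eq_bigr => a _ do rewrite mxE; rewrite e mulr0.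
have {}sP (a : 'I_#|J|) : nth x0 (enum I) a = tau S (nth x0 (enum J) (s a))
    /\ nth x0 (enum J) (s a) \in supp S.
  move/prodf_neq0: sP => /(_ a isT); rewrite mxE inE.
  by case: ifP => [/eqP->|]; rewrite ?eqxx.
have JS : J \subset supp S.
  apply/fintype.subsetP => j; rewrite -{1}(nth_enum_imset x0 (erefl #|J|)).
  by case/imsetP => b _ ->; have [_] := sP ((s^-1)%g b); rewrite permKV.
split=> //; apply/eqP; rewrite eqEcard card_imset; last exact/inv_inj/tauK.
rewrite cIJ leqnn andbT; apply/fintype.subsetP => i.
rewrite -{1}(nth_enum_imset x0 cIJ) => /imsetP [a _ ->].
by have [-> _] := sP a; apply/imset_f/mem_nth_enum.
Qed.

(* The 0-1 matrix of tau from P to tau(P) transports the Vandermonde matrix of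
   the increasing list of tau(P) to that of the list tau(p_1), ..., tau(p_k),
   so its determinant has the sign of the latter's. *)
Lemma minor_shape_sign (x0 : 'I_N) S (P : {set 'I_N}) : P \subset supp S ->
  0 < (-1) ^+ inversions P (tau S) * (\prod_(p in P) phase S p)^*
      * minor (shape_mx S) [set tau S p | p in P]%SET P.
Proof.
move=> /fintype.subsetP PS; set tP := imset _ _; set k := #|P|.
have taui : injective (tau S) by apply/inv_inj/tauK.
have ctP : #|tP| = k by rewrite card_imset.
pose p (b : 'I_k) := nth x0 (enum P) b.
pose r (a : 'I_k) := nth x0 (enum tP) a.
have pi : injective p by apply: nth_enum_inj.
have ri : injective r by apply: nth_enum_inj.
pose A : 'M[C]_k := \matrix_(a, b) (r a == tau S (p b))%:R.
have ra b : exists a, r a = tau S (p b).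
  have : tau S (p b) \in r @: 'I_k.
    rewrite (nth_enum_imset x0 ctP); exact/imset_f/mem_nth_enum.
  by case/imsetP => a _ ->; exists a.
have -> : minor (shape_mx S) tP P = \det A * \prod_(p in P) phase S p.
  rewrite (@minorE _ _ x0 k) //.
  have -> : \prod_(p in P) phase S p = \det (diag_mx (\row_b phase S (p b))).
    rewrite det_diag -[in LHS](nth_enum_imset x0 (erefl #|P|)) big_imset /=.
      by apply: eq_big => [b|b _]; rewrite ?inE // mxE.
    by move=> ? ? _ _; apply: pi.
  rewrite -det_mulmx; congr (\det _); apply/matrixP => a b.
  rewrite mul_mx_diag !mxE -/(r a) -/(p b).
  by case: eqP => _; rewrite ?mul1r ?mul0r.
have VA : Vandermonde k (\row_a (r a)%:R) *m A
        = Vandermonde k (\row_b (tau S (p b))%:R).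
  apply/matrixP => i b; rewrite !mxE; have [a ea] := ra b.
  rewrite (bigD1 a) //= big1 => [|c ca].
    by rewrite !mxE ea eqxx mulr1 addr0.
  by rewrite !mxE -ea (inj_eq ri) (negbTE ca) mulr0.
have Vr : 0 < \det (Vandermonde k (\row_a (r a)%:R : 'rV[C]_k)).
  have := @vandermonde_sign C k (fun a => r a) (fun a b e => ri a b (val_inj e)).
  rewrite [in X in #|X|](_ : finset _ = finset.set0) ?cards0 ?mul1r //.
  apply/setP => -[a b]; rewrite !inE /=; rewrite !ltn_nth_enum ?ctP //.
  by case: ltngtP.
have Vt := @vandermonde_sign C k (fun b => tau S (p b))
  (fun a b e => pi a b (taui _ _ (val_inj e))).
have cinv : inversions P (tau S) = #|[set x : 'I_k * 'I_k |
     (x.1 < x.2)%N && (tau S (p x.2) < tau S (p x.1))%N]%SET|.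
  pose g (x : 'I_k * 'I_k) := (p x.1, p x.2).
  have gi : injective g by move=> [a b] [c d] [] /pi -> /pi ->.
  rewrite /inversions -(card_imset _ gi); apply: eq_card => -[i j].
  apply/idP/imsetP.
    move=> /set_mem /= /and4P []; rewrite -{1 2}(nth_enum_imset x0 (erefl #|P|)).
    move=> /imsetP [a _ ->] /imsetP [b _ ->] ab tab; exists (a, b) => //.
    by rewrite inE /= -(ltn_nth_enum x0 (A := P)) ?ab.
  case=> -[a b]; rewrite inE /= => /andP [ab tab] [-> ->]; apply/mem_set => /=.
  by rewrite !mem_nth_enum //= tab ltn_nth_enum // ab.
have {}Vt : 0 < (-1) ^+ inversions P (tau S) * \det A.
  rewrite -(pmulr_rgt0 _ Vr) mulrCA -det_mulmx VA cinv; exact: Vt.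
(* What remains beside the signed determinant is the phase product times its conjugate, a squared
   modulus. *)
rewrite mulrACA mulr_gt0 // mulrC -normCK exprn_gt0 // normr_gt0.
by apply/prodf_neq0 => i /PS; rewrite inE.
Qed.

Lemma supp_init_sub S k : supp_init S k \subset supp S.
Proof.
by apply/fintype.subsetP => i; rewrite inE => /mem_take; rewrite mem_enum.
Qed.

Lemma of_shape_shape_mx (x0 : 'I_N) S : of_shape (shape_mx S) S.
Proof.
split=> [|k kr P tP]; first by rewrite rank_shape_mx.
have cP : #|P| = k by apply: card_supp_init.
split=> [I J cI cJ lt|]; last exact: (minor_shape_sign x0 (supp_init_sub S k)).
apply/eqP; apply: contraTT lt => /(minor_shape_neq0 x0) []; rewrite ?cI //.
move=> JS EI; rewrite lex_ltE; have [e|lt] := supp_init_min JS cJ.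
  by rewrite EI e !set_lt_irr andbF.
rewrite negb_or; apply/andP; split.
  by apply: contraL lt => lt'; rewrite /set_lt lt_gtF.
rewrite negb_and; apply/orP; left.
by apply: contraTneq lt => ->; rewrite set_lt_irr.
Qed.

End ShapeMatrix.

(** * Recovering a shape from the first nonvanishing minors *)

Section ShapeUniqueness.
Variables (R : realType) (N : nat).
Local Notation C := R[i].
Implicit Types (z : 'M[C]_N) (S T : Shape R N).

Lemma shape_ext S T : tau S =1 tau T -> phase S =1 phase T -> S = T.
Proof.
case: S T => [ta u a1 a2 a3] [tb v b1 b2 b3] /= /ffunP et /ffunP eu.
by subst tb v; congr MkShape; apply: bool_irrelevance.
Qed.

Lemma supp_init_full S : supp_init S (shape_rank S) = supp S.
Proof.
by apply/setP => i; rewrite inE /shape_rank cardE take_size mem_enum.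
Qed.

(** Consecutive initial segments isolate a single support element, which lets data known only on
    segments be read off pointwise. *)
Lemma supp_initS S i : i \in supp S ->
  exists2 k, (k < shape_rank S)%N &
    supp_init S k.+1 = (i |: supp_init S k)%SET /\ i \notin supp_init S k.
Proof.
move=> iS; set e := enum (supp S).
have ie : i \in e by rewrite mem_enum.
have ke : (index i e < size e)%N by rewrite index_mem.
have E : take (index i e).+1 e = rcons (take (index i e) e) i.
  by rewrite (take_nth i) // nth_index.
exists (index i e); first by rewrite /shape_rank cardE.
split; first by apply/setP => j; rewrite in_setU1 !inE E mem_rcons inE.
have := take_uniq (index i e).+1 (enum_uniq (supp S)).
by rewrite E rcons_uniq inE => /andP [].
Qed.

(* The pair (P_[k], tau P_[k]) is the lexicographically first pair of
   k-subsets with a nonvanishing minor. *)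
Lemma of_shape_first_minor z S T k : of_shape z S -> of_shape z T ->
  (k <= shape_rank S)%N -> (k <= shape_rank T)%N ->
  supp_init S k = supp_init T k /\
  [set tau S p | p in supp_init S k]%SET = [set tau T p | p in supp_init T k]%SET.
Proof.
have half A B : of_shape z A -> of_shape z B ->
    (k <= shape_rank A)%N -> (k <= shape_rank B)%N ->
    lex_lt (supp_init A k) [set tau A p | p in supp_init A k]%SET
      (supp_init B k) [set tau B p | p in supp_init B k]%SET = false.
  move=> [_ hA] [_ hB] kA kB; apply/negbTE/negP => lt.
  have [_ pA] := hA k kA; have [zB _] := hB k kB.
  move: pA; rewrite zB ?mulr0 ?ltxx // ?card_imset ?card_supp_init //.
  exact/inv_inj/tauK.
move=> hS hT kS kT; have := half _ _ hS hT kS kT; have := half _ _ hT hS kT kS.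
rewrite !lex_ltE; case/or3P: (set_lt_total (supp_init S k) (supp_init T k));
  [by move=> ->|move/eqP=> e|by move=> ->].
rewrite e eqxx !set_lt_irr /=; set A := imset _ _; set B := imset _ _.
by case/or3P: (set_lt_total A B) => [->//|/eqP->//|->].
Qed.

(** The quotient of [a] by [b] is positive and of modulus one, hence equal to 1. *)
Lemma normr1_div_eq (a b s m : C) : `|a| = 1 -> `|b| = 1 ->
  0 < s * a * m -> 0 < s * b * m -> a = b.
Proof.
move=> a1 b1 pa pb; have b0 : b != 0 by rewrite -normr_eq0 b1 oner_eq0.
have : 0 < a / b.
  have -> : a / b = (s * a * m) / (s * b * m).
    have := gt_eqF pb; rewrite !mulf_eq0 => /norP [/norP [s0 _] m0].
    rewrite -(mulrA s a) -(mulrA s b) -mulf_div divff // mul1r.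
    by rewrite -mulf_div divff ?mulr1.
  by rewrite divr_gt0.
move/gtr0_norm; rewrite normrM normfV a1 b1 invr1 mulr1 => /esym/eqP.
rewrite -subr_eq0 -(mulIr_eq0 _ (mulIf b0)) mulrBl mul1r divfK //.
by rewrite subr_eq0 => /eqP.
Qed.

(** The full segment gives the support. For its element [i] added at stage [k.+1], [tau S i] is the
    only new element of the image of the segment, and [phase S i] is the quotient of consecutive
    phase products. Off the support [tau] is the identity and the phase is 0. *)
Lemma of_shape_unique z S T : of_shape z S -> of_shape z T -> S = T.
Proof.
move=> hS hT; have rST : shape_rank S = shape_rank T by rewrite hS.1 hT.1.
have first k : (k <= shape_rank S)%N -> supp_init S k = supp_init T k /\
    [set tau S p | p in supp_init S k]%SET = [set tau T p | p in supp_init T k]%SET.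
  by move=> kS; apply: (of_shape_first_minor hS hT); rewrite -?rST.
have suppE : supp S = supp T.
  by rewrite -!supp_init_full -rST; case: (first _ (leqnn _)).
have tauE : tau S =1 tau T.
  move=> i; have [iS|iS] := boolP (i \in supp S); last first.
    by rewrite !tau_notin_supp // -suppE.
  have [k kr [Sk ik]] := supp_initS iS.
  have [Pk tk] := first k (ltnW kr); have [Pk1 tk1] := first k.+1 kr.
  have : tau S i \in [set tau T p | p in supp_init T k.+1]%SET.
    by rewrite -tk1 Sk imset_f // setU11.
  rewrite -Pk1 Sk imsetU1 in_setU1 Pk -tk => /orP [/eqP//|].
  by rewrite mem_imset ?(negbTE ik) //; apply/inv_inj/tauK.
apply: shape_ext => // i.
have [iS|iS] := boolP (i \in supp S); last first.
  by move: iS (iS); rewrite {1}suppE !inE !negbK => /eqP-> /eqP->.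
have n1 (A : Shape R N) k : `|(\prod_(p in supp_init A k) phase A p)^*| = 1.
  rewrite norm_conjC normr_prod; apply: big1 => p pA.
  have := fintype.subsetP (supp_init_sub A k) p pA; rewrite inE.
  by have [->|] := phase0_or_norm1 A p; rewrite ?eqxx.
have prodE k : (k <= shape_rank S)%N ->
    \prod_(p in supp_init S k) phase S p = \prod_(p in supp_init S k) phase T p.
  move=> kr; have [Pk tk] := first k kr.
  have [_ /(_ k kr) [_ pS]] := hS; have [_ /(_ k)] := hT.
  rewrite -rST => /(_ kr) [_ pT].
  apply: (can_inj (@conjCK C)); rewrite [in RHS]Pk.
  apply: normr1_div_eq (n1 S k) (n1 T k) pS _.
  rewrite tk Pk; suff -> : inversions (supp_init T k) (tau S) =
    inversions (supp_init T k) (tau T) by [].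
  by congr inversions; apply: funext.
have [k kr [Sk ik]] := supp_initS iS.
have := prodE k.+1 kr; rewrite Sk !big_setU1 //= prodE ?(ltnW kr) //.
apply: mulIf; rewrite -prodE ?(ltnW kr) //; apply/eqP => e0.
by have := n1 S k; rewrite e0 conjC0 normr0 => /esym/eqP; rewrite oner_eq0.
Qed.

End ShapeUniqueness.

(** * Self-adjoint Gaussian elimination by upper triangular congruences *)

Section Elimination.
Variables (R : realType) (N : nat).
Local Notation C := R[i].
Implicit Types (z t : 'M[C]_N) (c : 'I_N -> C) (D : {set 'I_N}).

(** The identity with [c] added to row [p]: multiplying by it on the right adds [c j] times column
    [p] to column [j], and in particular scales column [p] by [1 + c p]. *)
Definition row_add p c : 'M[C]_N :=
  \matrix_(i, j) ((i == j)%:R + (i == p)%:R * c j).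

Lemma triang_row_add (p : 'I_N) c : (forall j : 'I_N, (j < p)%N -> c j = 0) ->
  0 < 1 + c p -> triang (row_add p c).
Proof.
move=> c0 cp; split=> [i j ji|i]; rewrite mxE.
  rewrite -val_eqE gtn_eqF // add0r.
  by case: eqVneq => [ip|_]; rewrite ?mul0r // c0 ?mulr0 // -ip.
rewrite eqxx; case: eqVneq => [->|_]; first by rewrite mul1r.
by rewrite mul0r addr0 ltr01.
Qed.

Lemma mul_row_add z p c i j : (z *m row_add p c) i j = z i j + z i p * c j.
Proof.
rewrite mxE; under eq_bigr do rewrite mxE mulrDr mulrA.
rewrite big_split /=; congr (_ + _).
  rewrite (bigD1 j) //= eqxx mulr1 big1 ?addr0 // => k /negbTE ->.
  by rewrite mulr0.
rewrite (bigD1 p) //= eqxx mulr1 big1 ?addr0 // => k /negbTE ->.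
by rewrite mulr0 mul0r.
Qed.

Lemma conjtrE (A : 'M[C]_N) i j : (A^t*) i j = (A j i)^*.
Proof. by rewrite !mxE. Qed.

Lemma act_row_addE z p c i j :
  ((row_add p c)^t* *m z *m row_add p c) i j =
    z i j + z i p * c j + (z p j + z p p * c j) * (c i)^*.
Proof.
have L (w : 'M[C]_N) k l : ((row_add p c)^t* *m w) k l = w k l + w p l * (c k)^*.
  rewrite -[_ *m w]conjtrK conjtr_mul conjtrK conjtrE mul_row_add !conjtrE.
  by rewrite rmorphD rmorphM /= !conjCK.
by rewrite -mulmxA L !mul_row_add.
Qed.

Definition congruent z w := exists2 t, triang t & w = t^t* *m z *m t.

Lemma congruent_trans z w x : congruent z w -> congruent w x -> congruent z x.
Proof.
move=> [s sT ->] [t tT ->]; exists (s *m t); first exact: triangM.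
by rewrite conjtr_mul !mulmxA.
Qed.

Lemma congruent_refl z : congruent z z.
Proof. by have [t tT e] := Ad_orbit_refl z; exists t. Qed.

Lemma herm_congruent z w : congruent z w -> herm z -> herm w.
Proof. by case=> t _ ->; apply: herm_act. Qed.

Lemma herm_sym z i j : herm z -> z i j = (z j i)^*.
Proof. by move/hermE => {1}<-; rewrite !mxE. Qed.

Lemma herm_neq0 z i j : herm z -> (z i j != 0) = (z j i != 0).
Proof. by move=> hz; rewrite (herm_sym i j hz) conjC_eq0. Qed.

(** A zero row qualifies. Requiring the column of the unit entry to lie in [D] makes the processed
    indices decouple from the others when [z] is self-adjoint. *)
Definition row_reduced z D i := forall j, z i j != 0 ->
  [/\ j \in D, `|z i j| = 1 & forall k, z i k != 0 -> k = j].

Definition reduced z D := forall i, i \in D -> row_reduced z D i.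

Lemma row_reducedS z D (E : {set 'I_N}) i : D \subset E -> row_reduced z D i ->
  row_reduced z E i.
Proof. by move=> /fintype.subsetP DE h j /h [/DE ? ? ?]; split. Qed.

Lemma reduced_eq0 z D i j : herm z -> reduced z D -> i \in D -> j \notin D ->
  z i j = 0 /\ z j i = 0.
Proof.
move=> hz rz iD jD; have e : z i j = 0.
  by apply/eqP; apply: contraNT jD => /(rz i iD) [].
by split=> //; rewrite (herm_sym _ _ hz) e conjC0.
Qed.

(** Rows of [D] have entry 0 in column [p], as [p] is outside [D], and receive nothing because [c]
    vanishes on [D]. *)
Lemma reduced_row_add z D p c : herm z -> reduced z D -> p \notin D ->
  (forall i, i \in D -> c i = 0) ->
  reduced ((row_add p c)^t* *m z *m row_add p c) D.
Proof.
move=> hz rz pD c0 i iD j.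
have E k : ((row_add p c)^t* *m z *m row_add p c) i k = z i k.
  rewrite act_row_addE (c0 i iD) conjC0 mulr0 addr0.
  by have [-> _] := reduced_eq0 hz rz iD pD; rewrite mul0r addr0.
by rewrite E => /(rz i iD) [? ? h]; split=> // k; rewrite E; apply: h.
Qed.

Lemma pivot_diag z D (p : 'I_N) : herm z -> reduced z D -> p \notin D ->
  (forall j : 'I_N, (j < p)%N -> z p j = 0) -> z p p != 0 ->
  exists2 w, congruent z w & reduced w (p |: D)%SET.
Proof.
move=> hz rz pD zp0 zpp.
have cD i : i \in D -> z p i = 0 by move=> iD; case: (reduced_eq0 hz rz iD pD).
(* The pivot is scaled once from each side, so the inverse square root brings its modulus to 1. *)
pose a : C := (sqrtC `|z p p|)^-1.
have a0 : 0 < a by rewrite invr_gt0 sqrtC_gt0 normr_gt0.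
pose c j := if j == p then a - 1 else - (z p j / z p p).
have cp : 1 + c p = a by rewrite /c eqxx addrC subrK.
pose w := (row_add p c)^t* *m z *m row_add p c.
have wE j : w p j = a * (z p j + z p p * c j).
  rewrite /w act_row_addE -[X in X + _]mulr1 -mulrDr mulrC; congr (_ * _).
  rewrite /c eqxx rmorphB rmorph1 /= (conj_Creal (gtr0_real a0)).
  by rewrite addrC subrK.
have w0 j : j != p -> w p j = 0.
  move=> jp; rewrite wE /c (negbTE jp) mulrN mulrC -[X in _ - X]mulrC.
  by rewrite divfK // subrr mul0r.
exists w.
  exists (row_add p c) => //; apply: triang_row_add; rewrite ?cp // => j jp.
  by rewrite /c -val_eqE ltn_eqF //= zp0 // mul0r oppr0.
have rw : reduced w D.
  apply: reduced_row_add => // i iD; rewrite /c (cD i iD) mul0r oppr0.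
  by case: eqVneq iD pD => [->->|].
move=> i; rewrite in_setU1 => /orP [/eqP->|iD]; last first.
  by apply: row_reducedS (rw i iD); apply: finset.subsetUr.
have wp j : w p j != 0 -> j = p by move=> h; apply: contraNeq h => /w0 ->.
move=> j wj; have -> := wp j wj; rewrite setU11; split=> //.
rewrite wE -{1}[z p p]mulr1 -mulrDr cp !normrM (gtr0_norm a0).
rewrite mulrCA -expr2 /a exprVn sqrtCK divff // normr_eq0 //.
Qed.

(* Off the diagonal a pivot z_pq, p < q, needs two steps: column q clears and
   normalizes row p; then row p, whose only entry is at q, clears row q. *)
Lemma pivot_normalize z D (p q : 'I_N) : herm z -> reduced z D -> p \notin D ->
  q \notin D -> (forall j : 'I_N, (j < q)%N -> z p j = 0) -> (p < q)%N ->
  z p q != 0 ->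
  exists2 w, congruent z w &
    [/\ reduced w D, `|w p q| = 1 & forall j, j != q -> w p j = 0].
Proof.
move=> hz rz pD qD zp0 pq zpq.
have cD i : i \in D -> z p i = 0 by move=> iD; case: (reduced_eq0 hz rz iD pD).
pose c j := if j == q then `|z p q|^-1 - 1 else - (z p j / z p q).
have cq : 1 + c q = `|z p q|^-1 by rewrite /c eqxx addrC subrK.
have c0 (j : 'I_N) : (j < q)%N -> c j = 0.
  by move=> jq; rewrite /c -val_eqE ltn_eqF //= zp0 // mul0r oppr0.
exists ((row_add q c)^t* *m z *m row_add q c).
  exists (row_add q c) => //; apply: triang_row_add => //.
  by rewrite cq invr_gt0 normr_gt0.
split.
- apply: reduced_row_add => // i iD; rewrite /c (cD i iD) mul0r oppr0.
  by case: eqVneq iD qD => [->->|].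
- rewrite act_row_addE (c0 p) // conjC0 mulr0 addr0.
  rewrite -[X in X + _]mulr1 -mulrDr cq normrM normfV normr_id divff //.
  by rewrite normr_eq0.
move=> j jq; rewrite act_row_addE (c0 p) // conjC0 mulr0 addr0 /c (negbTE jq).
by rewrite mulrN mulrCA divff // mulr1 subrr.
Qed.

Lemma pivot_offdiag z D (p q : 'I_N) : herm z -> reduced z D -> p \notin D ->
  q \notin D -> p != q -> (forall j : 'I_N, (j < p)%N -> j \in D) ->
  `|z p q| = 1 -> (forall j, j != q -> z p j = 0) ->
  exists2 w, congruent z w & reduced w (p |: (q |: D))%SET.
Proof.
move=> hz rz pD qD pq ltD npq zp0.
have cD i : i \in D -> z q i = 0 by move=> iD; case: (reduced_eq0 hz rz iD qD).
have nqp : `|z q p| = 1 by rewrite (herm_sym _ _ hz) norm_conjC.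
have zqp : z q p != 0 by rewrite -normr_eq0 nqp oner_eq0.
have zpp : z p p = 0 by apply: zp0.
(* Row [p] has its only entry at [q], so adding multiples of column [p] can clear row [q]. The
   diagonal entry at [q] is hit from both sides, by a term and its conjugate, hence the half;
   [z q q] is real. *)
pose c j := if j == p then 0 else
  if j == q then - (z q q / 2 / z q p) else - (z q j / z q p).
have cp : c p = 0 by rewrite /c eqxx.
have cD0 i : i \in D -> c i = 0.
  move=> iD; rewrite /c (cD i iD) mul0r oppr0; case: ifP => // _.
  by case: eqVneq iD qD => [->->|].
pose w := (row_add p c)^t* *m z *m row_add p c.
have wp j : w p j = z p j.
  by rewrite /w act_row_addE zpp cp conjC0 mulr0 mul0r !addr0.
have wq j : w q j = z q j + z q p * c j + z p j * (c q)^*.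
  by rewrite /w act_row_addE zpp mul0r addr0.
have wqp : w q p = z q p by rewrite wq cp zpp mulr0 mul0r !addr0.
have wq0 j : j != p -> w q j = 0.
  move=> jp; rewrite wq; have [->|jq] := eqVneq j q; last first.
    rewrite zp0 // mul0r addr0 /c (negbTE jp) (negbTE jq).
    by rewrite mulrN mulrCA divff // mulr1 subrr.
  have cq : z q p * c q = - (z q q / 2).
    by rewrite /c eq_sym (negbTE pq) eqxx mulrN mulrCA divff // mulr1.
  have -> : z p q * (c q)^* = (z q p * c q)^*.
    by rewrite rmorphM /= -(herm_sym _ _ hz).
  rewrite cq rmorphN rmorphM /= -(herm_sym _ _ hz) fmorphV /= conjC_nat.
  by rewrite -addrA -opprD -splitr subrr.
have rw : reduced w D by apply: reduced_row_add.
exists w.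
  (* Indices below [p] all lie in [D], where [c] vanishes; this gives triangularity. *)
  exists (row_add p c) => //; apply: triang_row_add; last by rewrite cp addr0.
  by move=> j /ltD /cD0.
move=> i; rewrite !in_setU1 => /or3P [/eqP->|/eqP->|iD] j.
- have h k : z p k != 0 -> k = q by move=> zk; apply: contraNeq zk => /zp0 ->.
  rewrite wp => /h ->; rewrite !inE eqxx orbT; split=> // k.
  by rewrite wp => /h.
- have h k : w q k != 0 -> k = p by move=> zk; apply: contraNeq zk => /wq0 ->.
  by move=> /h ->; rewrite wqp !inE eqxx; split.
have DE : D \subset (p |: (q |: D))%SET.
  by apply/fintype.subsetP => k kD; rewrite !inE kD !orbT.
exact: (row_reducedS DE (rw i iD)).
Qed.

(** The pivot row is the least [p] outside [D] and the pivot column the least [q] with a nonzero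
    entry in that row. A zero row enlarges [D] at no cost; a pivot adds [p], together with [q] if it
    is off the diagonal. *)
Lemma pivot_step z D : herm z -> reduced z D -> D != [set: 'I_N]%SET ->
  exists w E, [/\ congruent z w, reduced w E & D \proper E].
Proof.
move=> hz rz DT.
have [p0 p0D] : exists p, p \notin D.
  apply/existsP; apply: contraNT DT; rewrite negb_exists => /forallP h.
  by apply/eqP/setP => i; rewrite !inE; move: (h i); rewrite negbK.
case: (@arg_minnP _ p0 (fun p => p \notin D) val p0D) => p pD pmin.
have ltD (j : 'I_N) : (j < p)%N -> j \in D.
  by move=> jp; apply: contraTT jp => /pmin; rewrite -leqNgt.
have prop (E : {set 'I_N}) : D \subset E -> p \in E -> D \proper E.
  by move=> DE pE; apply/properP; split=> //; exists p.
have [zp|/forallPn [q0 zq0]] := boolP [forall j, z p j == 0].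
  exists z, (p |: D)%SET; split; [exact: congruent_refl| |].
    move=> i; rewrite in_setU1 => /orP [/eqP->|/rz] => [j|].
      by rewrite (eqP (forallP zp j)) eqxx.
    by apply: row_reducedS; apply: finset.subsetUr.
  by apply: prop; rewrite ?setU11 ?finset.subsetUr.
case: (@arg_minnP _ q0 (fun q => z p q != 0) val zq0) => q zpq qmin.
have zp0 (j : 'I_N) : (j < q)%N -> z p j = 0.
  by move=> jq; apply/eqP; apply: contraTT jq => /qmin; rewrite -leqNgt.
(* Were [q] in [D], its reduced row with the nonzero entry at [p] would put [p] in [D]. *)
have qD : q \notin D.
  have zqp : z q p != 0 by rewrite herm_neq0.
  by apply: contraNN pD => qD; have [] := rz q qD p zqp.
have [pq|pq] := eqVneq p q.
  rewrite -pq in zpq zp0; have [w zw rw] := pivot_diag hz rz pD zp0 zpq.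
  exists w, (p |: D)%SET; split=> //.
  by apply: prop; rewrite ?setU11 ?finset.subsetUr.
have ltpq : (p < q)%N by rewrite ltn_neqAle val_eqE pq pmin.
have [w zw [rw nw w0]] := pivot_normalize hz rz pD qD zp0 ltpq zpq.
have [x wx rx] := pivot_offdiag (herm_congruent zw hz) rw pD qD pq ltD nw w0.
exists x, (p |: (q |: D))%SET; split=> //; first exact: congruent_trans wx.
apply: prop; rewrite ?setU11 //.
by apply/fintype.subsetP => k kD; rewrite !inE kD !orbT.
Qed.

Lemma exists_reduced z : herm z ->
  exists2 w, congruent z w & reduced w [set: 'I_N]%SET.
Proof.
move=> hz.
suff H D y : herm y -> reduced y D ->
    exists2 w, congruent y w & reduced w [set: 'I_N]%SET.
  by apply: (H finset.set0 z hz) => i; rewrite inE.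
have [n] := ubnP #|~: D|%SET; elim: n D y => // n IHn D y le_n hy ry.
have [<-|DT] := eqVneq D [set: 'I_N]%SET.
  by exists y => //; exact: congruent_refl.
have [w [E [yw rw DE]]] := pivot_step hy ry DT.
have [|x wx rx] := IHn E w _ (herm_congruent yw hy) rw.
  rewrite -ltnS; apply: leq_trans le_n; rewrite ltnS; apply: proper_card.
  by rewrite properC.
by exists x => //; exact: congruent_trans wx.
Qed.

Lemma reduced_shape z : herm z -> reduced z [set: 'I_N]%SET ->
  exists2 S : Shape R N, shape_sa S & shape_mx S = z.
Proof.
move=> hz rz.
(* The default [i] fixes the indices of zero rows, as a shape must where the phase is 0. *)
pose ta i := odflt i [pick j | z i j != 0].
have taE i j : z i j != 0 -> ta i = j.
  move=> zij; rewrite /ta; case: pickP => [k zik|/(_ j)] /=; last by rewrite zij.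
  by have [|_ _ /(_ k zik)] := rz i _ j zij; rewrite ?inE.
have ta_neq0 i : ta i != i -> z i (ta i) != 0.
  by rewrite /ta; case: pickP => //= _; rewrite eqxx.
have taK i : ta (ta i) = i.
  have [e|/ta_neq0] := eqVneq (ta i) i; first by rewrite !e.
  by rewrite herm_neq0 // => /taE.
pose ta' := [ffun i => ta i]; pose u := [ffun i => z (ta i) i].
have a1 : [forall i, ta' (ta' i) == i].
  by apply/forallP => i; rewrite !ffunE taK.
have a2 : [forall i, (u i == 0) || (`|u i| == 1)].
  apply/forallP => i; rewrite !ffunE; have [//|h] := eqVneq (z (ta i) i) 0.
  by have [|_ -> _] := rz (ta i) _ i h; rewrite ?inE ?eqxx.
have a3 : [forall i, (ta' i != i) ==> (u i != 0)].
  apply/forallP => i; rewrite !ffunE; apply/implyP => /ta_neq0.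
  by rewrite herm_neq0.
exists (MkShape a1 a2 a3) => [i|] /=.
  by rewrite !ffunE taK; apply: herm_sym.
apply/matrixP => j i; rewrite mxE /= !ffunE; case: eqVneq => [->//|jt].
apply/esym/eqP; apply: contraNT jt; rewrite herm_neq0 // => /taE ->.
by rewrite eqxx.
Qed.

Lemma herm_congruent_shape z : herm z ->
  exists2 S : Shape R N, shape_sa S & congruent z (shape_mx S).
Proof.
move=> hz; have [w zw rw] := exists_reduced hz.
have [S saS SE] := reduced_shape (herm_congruent zw hz) rw.
by exists S; rewrite ?SE.
Qed.

End Elimination.

(** * Self-adjoint shapes as representatives of the orbits *)

Lemma herm_shape_mx (R : realType) (N : nat) (S : Shape R N) :
  shape_sa S -> herm (shape_mx S).
Proof.
move=> saS; apply/hermE/matrixP => i j; rewrite conjtrE !mxE.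
rewrite -(inv_eq (@tauK _ _ S)) [tau S j == i]eq_sym; case: eqVneq => [->|_].
  by rewrite saS conjCK.
by rewrite conjC0.
Qed.

Lemma congruent_orbit (R : realType) (N : nat) (z w : 'M[R[i]]_N) :
  congruent z w -> Ad_orbit w = Ad_orbit z.
Proof. by case=> t tT ->; apply: Ad_orbit_act. Qed.

Lemma orbit_congruent (R : realType) (N : nat) (z w : 'M[R[i]]_N) :
  Ad_orbit w = Ad_orbit z -> congruent z w.
Proof.
by move=> e; have := Ad_orbit_refl w; rewrite e => -[t tT <-]; exists t.
Qed.

Lemma of_shape_orbit (R : realType) (N : nat) (x0 : 'I_N) (z w : 'M[R[i]]_N)
    (S : Shape R N) : Ad_orbit z = Ad_orbit w -> of_shape z S -> of_shape w S.
Proof. by move=> /esym/orbit_congruent [t tT ->]; apply: of_shape_act. Qed.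

Local Open Scope classical_set_scope.

Theorem theorem1p6 (R : realType) (N : nat) (hN : (0 < N)%N) :
  (forall z : 'M[R[i]]_N, herm z -> exists! S : Shape R N, of_shape z S) /\
  (forall (z : 'M[R[i]]_N) (S : Shape R N),
     herm z -> of_shape z S -> shape_sa S) /\
  set_bij (@sa_shapes R N) (@herm_orbits R N)
    (fun S => Ad_orbit (shape_mx S)) /\
  (exists g : set 'M[R[i]]_N -> Shape R N,
     (forall (z : 'M[R[i]]_N) (S : Shape R N),
        herm z -> of_shape z S -> g (Ad_orbit z) = S) /\
     (forall S : Shape R N, sa_shapes S -> g (Ad_orbit (shape_mx S)) = S) /\
     (forall O : set 'M[R[i]]_N, herm_orbits O ->
        sa_shapes (g O) /\ Ad_orbit (shape_mx (g O)) = O)).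
Proof.
pose x0 : 'I_N := Ordinal hN.
have shapeE (S : Shape R N) : of_shape (shape_mx S) S by apply: of_shape_shape_mx.
have sa_rep (z : 'M[R[i]]_N) : herm z ->
    exists2 S : Shape R N, shape_sa S & Ad_orbit (shape_mx S) = Ad_orbit z.
  by move=> /herm_congruent_shape [S saS /congruent_orbit]; exists S.
(* By invariance [z] is of shape [S], so [T] is the same shape. Uniqueness, self-adjointness,
   injectivity and the inverse formulas all reduce to this. *)
have orbit_shape (z : 'M[R[i]]_N) (S T : Shape R N) :
    Ad_orbit (shape_mx S) = Ad_orbit z -> of_shape z T -> S = T.
  by move=> e; apply: of_shape_unique; apply: of_shape_orbit e (shapeE S).
have [g gP] : {g : set 'M[R[i]]_N -> Shape R N & forall O, herm_orbits O ->
    sa_shapes (g O) /\ Ad_orbit (shape_mx (g O)) = O}.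
  apply: (@choice _ _ (fun O (S : Shape R N) => herm_orbits O ->
    sa_shapes S /\ Ad_orbit (shape_mx S) = O)) => O.
  have [[z hz <-]|nO] := pselect (herm_orbits O).
    by have [S saS SE] := sa_rep z hz; exists S.
  (* Outside the orbit space any value of [g] will do; the zero matrix supplies one. *)
  have h0 : herm (0 : 'M[R[i]]_N)%R by apply/hermE; rewrite trmx0 map_mx0.
  by have [S _ _] := sa_rep _ h0; exists S.
have horb (z : 'M[R[i]]_N) : herm z -> herm_orbits (Ad_orbit z) by exists z.
have hS (S : Shape R N) : sa_shapes S -> herm_orbits (Ad_orbit (shape_mx S)).
  by move=> saS; apply/horb/herm_shape_mx.
split=> [z hz|].
  have [S saS SE] := sa_rep z hz; exists S.
  split; last by move=> T; exact: orbit_shape.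
  exact: of_shape_orbit SE (shapeE S).
split=> [z S hz zS|].
  by have [T saT /orbit_shape/(_ zS) <-] := sa_rep z hz.
split.
  split=> [S /hS //|S T _ _ e|O [z hz <-]]; first exact: orbit_shape e (shapeE T).
  by have [S saS SE] := sa_rep z hz; exists S.
exists g; split=> [z S hz zS|].
  by have [_ e] := gP _ (horb z hz); apply: orbit_shape e zS.
split=> [S saS|//].
by have [_ e] := gP _ (hS S saS); apply: orbit_shape e (shapeE S).
Qed.
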